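(* Let $M\subset\mathbb N$ and $N\subset\mathbb N$ be two finite non-empty sets, let $P\supset\mathcal P(M)\cup\mathcal P(N)$ be a finite set of prime numbers, and let $(\succ_p^M)_{p\in P}$ and $(\succ_p^N)_{p\in P}$ be two tuples of excellent orders such that $M$ is compatible with $(\succ_p^M)_{p\in P}$ and $N$ is compatible with $(\succ_p^N)_{p\in P}$. Let $\chi:\mathbb N\to\mathbb N_0$, $\chi(l)=\sum_{(m,n)\in M\times N}\delta(m,n,l)$, with finite support $L=\{l\in\mathbb N\mid\chi(l)>0\}$. For any $p\in P$ and any $(m_0,n_0)\in\pi_p(M)\times\pi_p(N)$ define $\chi_{p,m_0,n_0}:L\to\mathbb N_0$ by $\chi_{p,m_0,n_0}(l)=\sum_{(m,n)\in(M\cap\pi_p^{-1}(m_0))\times(N\cap\pi_p^{-1}(n_0))}\delta(m,n,l)$, and extend it to $\mathbb N-L$ with values $0$. Write $\succ_p^L:=\succ_p^M\otimes\succ_p^N$ for any $p\in P$. Then: (a) Any $\chi_{p,m_0,n_0}$ is compatible with the excellent order $\succ_p^L$ in the following sense: $$(l_a,l_b)\in E_{V,p}\ \Rightarrow\ \chi_{p,m_0,n_0}(l_a)\geq\chi_{p,m_0,n_0}(l_b),$$ where $V=V((\succ_q^L)_{q\in P})$ and $E_{V,p}$ is determined by $\succ_p^L$. (b) $\chi$ is compatible with the tuple $(\succ_p^L)_{p\in P}$ of excellent orders. (c) The pair $(M,N)$ is sdiOb-sufficient.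
   Context: $\mathbb N=\{1,2,\dots\}$, $\mathbb N_0=\mathbb N\cup\{0\}$, $\mathbb Z_{[a,b]}=\mathbb Z\cap[a,b]$; $\varphi$ is Euler's phi-function; $v_p(m)$ is the exponent of the prime $p$ in $m$; $\pi_p(m):=m\cdot p^{-v_p(m)}$. $\mathcal P(M)$ is the set of primes dividing some element of $M$. Excellent orders: an excellent order $\succ$ on $\mathbb Z_{[0,s(\succ)]}$ (with $s(\succ)\in\mathbb N_0$) is a strict total order determined by the set $S(\succ):=\{k\in\mathbb Z_{[0,s(\succ)]}\mid k\succ 0\}$ as follows: $\succ$ equals $>$ on $S(\succ)\cup\{0\}$ and $\succ$ equals $<$ on $\mathbb Z_{[0,s(\succ)]}-S(\succ)$. The tensor product $\succ_1\otimes\succ_2$ is the excellent order with $s(\succ_1\otimes\succ_2)=\max(s(\succ_1),s(\succ_2))$ and $S(\succ_1\otimes\succ_2)=(S(\succ_1)\cup S(\succ_2))-(S(\succ_1)\cap S(\succ_2))$. For a tuple $(\succ_p)_{p\in P}$ of excellent orders ($P$ a finite set of primes) let $V=V((\succ_p)_{p\in P}):=\{\prod_{p\in P}p^{k_p}\mid k_p\in\mathbb Z_{[0,s(\succ_p)]}\}$, $E_{V,p}:=\{(m_a,m_b)\in V\times V\mid\pi_p(m_a)=\pi_p(m_b),\ v_p(m_a)\succ_pv_p(m_b)\}$ and $E_V:=\bigcup_{p\in P}E_{V,p}$. Compatibility: a set $K\subset\mathbb N_0$ is subset compatible with $\succ$ if $K=\mathbb Z_{[0,s(\succ)]}$ or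 $K=\{k\in\mathbb Z_{[0,s(\succ)]}\mid k\succ k_K\}$ for some $k_K\in\mathbb Z_{[0,s(\succ)]}$. For a set $M$, a prime $p$ and $m_0\in\pi_p(M)$ let $K_{M,p,m_0}:=\{k\in\mathbb N_0\mid m_0p^k\in M\}$. A finite non-empty set $M\subset\mathbb N$ is compatible with $(\succ_p)_{p\in P}$ (where $P\supset\mathcal P(M)$ is a finite set of primes) if $M\subset V((\succ_p)_{p\in P})$ and if for any prime number $p\in\mathcal P(M)$ and any $m_0\in\pi_p(M)$ the set $K_{M,p,m_0}$ is subset compatible with $\succ_p$ (so here the $\succ_p$ for $p\in P-\mathcal P(M)$ are irrelevant). A map $\chi:\mathbb N\to\mathbb N_0$ with finite support is compatible with $(\succ_p)_{p\in P}$ (where $P\supset\mathcal P(\mathrm{supp}(\chi))$) if $\mathrm{supp}(\chi)\subset V((\succ_p)_{p\in P})$ and $\chi(m_a)\geq\chi(m_b)$ for every $(m_a,m_b)\in E_V$. The function $\delta$: let $\beta(m,n):=\prod_{p\text{ prime}:\,v_p(m)=v_p(n)>0}p^{v_p(m)}$ and $$\delta(m,n,l):=\varphi(\gcd(m,n))\cdot\prod_{p\text{ prime}:\,0=v_p(c)<v_p(\beta(m,n))}\frac{p-2}{p-1}$$ if $\mathrm{lcm}(m,n)=c\cdot l$ with $c\mid\beta(m,n)$, and $\delta(m,n,l):=0$ otherwise. sdiOb-sufficiency: call $(l_a,l_b)\in L^2$ a $p$-edge of $L$ if $l_a/l_b=p^k$ for some $k\in\mathbb N$. The pair $(M,N)$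 is sdiOb-sufficient if for every prime $p$ and every $p$-edge $(l_a,l_b)$ of $L$ at least one of the following holds: (1) $\chi_{p,m_0,n_0}(l_b)\leq\chi_{p,m_0,n_0}(l_a)$ for all $(m_0,n_0)\in\pi_p(M)\times\pi_p(N)$; (2) $\chi_{p,m_0,n_0}(l_b)\geq\chi_{p,m_0,n_0}(l_a)$ for all $(m_0,n_0)\in\pi_p(M)\times\pi_p(N)$ (here $\chi_{p,m_0,n_0}$ is given by the same formula for any prime $p$).
   Formalization: In (a) (at the given p) and (b) (at all p in P) it is also assumed that S(≻_p^M) is empty if p∉P(M), and S(≻_p^N) is empty if p∉P(N); without this both fail, e.g. P={2}, M={1}, N={2}, both orders with s=1, S={1}. Part (c) is as stated. *)

(* Defs.v *)
From HB Require Import structures.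
From mathcomp Require Import all_boot all_order all_algebra finmap.

Set Implicit Arguments.
Unset Strict Implicit.
Unset Printing Implicit Defensive.

Import GRing.Theory Num.Theory.

Local Open Scope nat_scope.
Local Open Scope fset_scope.

(* Here N is {1, 2, ...}: finite subsets of N are M : {fset nat} with
   0 \notin M, and a map N -> N_0 is a function nat -> nat whose value at 0 is
   never looked at.  On m > 0 and p prime, v_p(m) is logn p m. *)

Definition pi_p (p m : nat) : nat := m %/ p ^ logn p m.

Definition pi_img (p : nat) (M : {fset nat}) : {fset nat} :=
  [fset pi_p p m | m in M].

Definition primes_of (M : {fset nat}) : pred nat :=
  [pred p | prime p && has (dvdn p) M].

(* The relation is confined to [0, xo_s], so that an excellent order is
   determined by xo_s and xo_S (see xo_gt_ext). *)
Record excellent_order := ExcellentOrder {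
  xo_s : nat;
  xo_gt : rel nat;
  xo_dom : forall a b, xo_gt a b -> a <= xo_s /\ b <= xo_s;
  xo_irr : irreflexive xo_gt;
  xo_trans : transitive xo_gt;
  xo_total : forall a b, a <= xo_s -> b <= xo_s -> a != b ->
    xo_gt a b || xo_gt b a;
  xo_up : forall a b, xo_gt a 0 || (a == 0) -> xo_gt b 0 || (b == 0) ->
    xo_gt a b = (b < a);
  xo_down : forall a b, a <= xo_s -> b <= xo_s ->
    ~~ xo_gt a 0 -> ~~ xo_gt b 0 -> xo_gt a b = (a < b)
}.

Definition xo_S (o : excellent_order) : pred nat := fun k => xo_gt o k 0.

Lemma xo_S0 o : xo_S o 0 = false.
Proof. exact: xo_irr. Qed.

Lemma xo_S_le o k : xo_S o k -> k <= xo_s o.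
Proof. by case/xo_dom. Qed.

Lemma xo_gt_S_compl o a b :
  xo_S o a -> ~~ xo_S o b -> b <= xo_s o -> xo_gt o a b.
Proof.
move=> Sa nSb leb; have [->//|b0] := eqVneq b 0.
apply: (xo_trans Sa); rewrite xo_down ?lt0n //.
by rewrite -/(xo_S o 0) xo_S0.
Qed.

Lemma xo_gtE o a b :
  xo_gt o a b =
  [&& a <= xo_s o, b <= xo_s o &
    if xo_S o a then ~~ xo_S o b || (b < a) else ~~ xo_S o b && (a < b)].
Proof.
have [lea|ga] := leqP a (xo_s o); last first.
  by apply/negP => /xo_dom[]; rewrite leqNgt ga.
have [leb|gb] := leqP b (xo_s o); last first.
  by apply/negP => /xo_dom[_]; rewrite leqNgt gb.
case Sa: (xo_S o a); case Sb: (xo_S o b) => /=.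
- by rewrite xo_up // -/(xo_S o _) ?Sa ?Sb.
- by rewrite xo_gt_S_compl ?Sb.
- apply/negP => /xo_trans H.
  have := H _ (xo_gt_S_compl Sb (negbT Sa) lea).
  by rewrite xo_irr.
- by rewrite xo_down // -/(xo_S o _) ?Sa ?Sb.
Qed.

Lemma xo_gt_ext o1 o2 :
  xo_s o1 = xo_s o2 -> xo_S o1 =1 xo_S o2 -> xo_gt o1 =2 xo_gt o2.
Proof. by move=> es eS a b; rewrite !xo_gtE es !eS. Qed.

Section MkExcellent.
Variables (s : nat) (S : pred nat).

Definition mk_S : pred nat := [pred k | (0 < k <= s) && S k].

Definition mk_gt : rel nat := fun a b =>
  [&& a <= s, b <= s &
    if mk_S a then ~~ mk_S b || (b < a) else ~~ mk_S b && (a < b)].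

Lemma mk_gt0 k : mk_gt k 0 = mk_S k.
Proof.
rewrite /mk_gt /= ltn0.
case: k => [|k] /=; first by rewrite ?andbF.
by rewrite /mk_S /=; case: (k < s); case: (S _).
Qed.

Lemma mk_dom a b : mk_gt a b -> a <= s /\ b <= s.
Proof. by case/and3P. Qed.

Lemma mk_irr : irreflexive mk_gt.
Proof.
by move=> a; rewrite /mk_gt ltnn orbF andbF; case: (mk_S a); rewrite /= ?andbF.
Qed.

Lemma mk_trans : transitive mk_gt.
Proof.
move=> b a c /and3P[la lb h1] /and3P[_ lc h2]; apply/and3P; split=> //.
move: h1 h2; case: (mk_S a); case: (mk_S b); case: (mk_S c) => //= h1 h2.
  exact: ltn_trans h2 h1.
exact: ltn_trans h1 h2.
Qed.

Lemma mk_total a b : a <= s -> b <= s -> a != b -> mk_gt a b || mk_gt b a.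
Proof.
move=> la lb; rewrite /mk_gt la lb /= neq_ltn.
by case: (mk_S a); case: (mk_S b) => //= /orP[->|->]; rewrite ?orbT.
Qed.

Lemma mk_up a b : mk_gt a 0 || (a == 0) -> mk_gt b 0 || (b == 0) ->
  mk_gt a b = (b < a).
Proof.
rewrite !mk_gt0 => /orP[Sa|/eqP->] /orP[Sb|/eqP->]; rewrite ?mk_gt0.
- have [/andP[/andP[_ la] _] /andP[/andP[_ lb] _]] := (Sa, Sb).
  by rewrite /mk_gt la lb Sa Sb.
- by rewrite Sa; case/andP: Sa => /andP[-> _] _.
- by rewrite /mk_gt Sb /= andbF.
- by [].
Qed.

Lemma mk_down a b : a <= s -> b <= s -> ~~ mk_gt a 0 -> ~~ mk_gt b 0 ->
  mk_gt a b = (a < b).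
Proof.
by rewrite !mk_gt0 => la lb /negPf Sa Sb; rewrite /mk_gt la lb Sa Sb.
Qed.

Definition mk_excellent : excellent_order :=
  ExcellentOrder mk_dom mk_irr mk_trans mk_total mk_up mk_down.

End MkExcellent.

Definition xo_tensor (o1 o2 : excellent_order) : excellent_order :=
  mk_excellent (maxn (xo_s o1) (xo_s o2))
    [pred k | (xo_S o1 k || xo_S o2 k) && ~~ (xo_S o1 k && xo_S o2 k)].

Lemma xo_tensor_s o1 o2 : xo_s (xo_tensor o1 o2) = maxn (xo_s o1) (xo_s o2).
Proof. by []. Qed.

Lemma xo_tensor_S o1 o2 k :
  xo_S (xo_tensor o1 o2) k =
  (xo_S o1 k || xo_S o2 k) && ~~ (xo_S o1 k && xo_S o2 k).
Proof.
rewrite /xo_S /= mk_gt0 /mk_S /= -!/(xo_S _ _).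
case: k => [|k]; first by rewrite !xo_S0.
case S1: (xo_S o1 _); case S2: (xo_S o2 _); rewrite /= ?andbF ?andbT //.
  by rewrite leq_max (xo_S_le S1).
by rewrite leq_max (xo_S_le S2) orbT.
Qed.

(* A tuple indexed by P is a function o : nat -> excellent_order of which only
   the values on P are used. *)

Definition in_V (P : {fset nat}) (o : nat -> excellent_order) (m : nat) : Prop :=
  exists k : nat -> nat,
    (forall p, p \in P -> k p <= xo_s (o p)) /\ m = \prod_(p <- P) p ^ k p.

Definition edgeVp (P : {fset nat}) (o : nat -> excellent_order) (p ma mb : nat)
    : Prop :=
  [/\ in_V P o ma, in_V P o mb, pi_p p ma = pi_p p mb &
      xo_gt (o p) (logn p ma) (logn p mb)].

Definition edgeV (P : {fset nat}) (o : nat -> excellent_order) (ma mb : nat)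
    : Prop :=
  exists2 p, p \in P & edgeVp P o p ma mb.

Definition subset_compatible (K : pred nat) (o : excellent_order) : Prop :=
  (forall k, K k = (k <= xo_s o)) \/
  (exists2 kK, kK <= xo_s o & forall k, K k = (k <= xo_s o) && xo_gt o k kK).

Definition Kset (M : {fset nat}) (p m0 : nat) : pred nat :=
  [pred k | m0 * p ^ k \in M].

Definition set_compatible (P : {fset nat}) (o : nat -> excellent_order)
    (M : {fset nat}) : Prop :=
  [/\ M != fset0, 0 \notin M, {subset primes_of M <= P},
      forall m, m \in M -> in_V P o m &
      forall p, p \in primes_of M -> forall m0, m0 \in pi_img p M ->
        subset_compatible (Kset M p m0) (o p)].

(* set_compatible puts no condition on o p when p \in P does not divide any
   element of M, but the orders of the tensor products still depend on it: with
   P = {2}, M = {1}, N = {2} and both orders given by s = 1 and S = {1}, the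
   only nonzero value of chi is chi(2) = 1 although (1, 2) is an edge for the
   tensor product.  The condition below excludes this; it says that 0 is the largest
   element for o p, equivalently that the set Kset M p m0 = {0} is subset
   compatible with o p (see normalised_offP). *)
Definition normalised_off (M : {fset nat}) (o : nat -> excellent_order)
    (p : nat) : Prop :=
  p \notin primes_of M -> xo_S (o p) =1 pred0.

Lemma normalised_offP (o : excellent_order) :
  xo_S o =1 pred0 <-> subset_compatible (pred1 0) o.
Proof.
split=> [S0|].
  case s0: (xo_s o) => [|s].
    by left=> k; rewrite s0 leqn0.
  right; exists 1; rewrite ?s0 // => k.
  rewrite xo_gtE !S0 /= ltnS leqn0 s0 /=.
  by case: k => //= k; rewrite !andbF.
case=> [H k|[kK leK H] k].
  apply/negP => Sk; have := xo_S_le Sk; rewrite -H /= => /eqP k0.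
  by rewrite k0 xo_S0 in Sk.
apply/negP => Sk; have := H 0; rewrite leq0n /= => /esym gt0.
have := H k; rewrite (xo_S_le Sk) (xo_trans Sk gt0) /= => /eqP k0.
by rewrite k0 xo_S0 in Sk.
Qed.

Definition supp (chi : nat -> nat) : pred nat := [pred l | (0 < l) && (0 < chi l)].

Definition fun_compatible (P : {fset nat}) (o : nat -> excellent_order)
    (chi : nat -> nat) : Prop :=
  [/\ exists A : {fset nat}, {subset supp chi <= A},
      forall p l, prime p -> l \in supp chi -> p %| l -> p \in P,
      forall l, l \in supp chi -> in_V P o l &
      forall ma mb, edgeV P o ma mb -> chi mb <= chi ma].

Definition beta (m n : nat) : nat :=
  \prod_(p <- primes m | (0 < logn p m) && (logn p m == logn p n)) p ^ logn p m.

(* The quotient is exact: deltaE and delta0 give the formula over the rationals. *)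
Definition delta (m n l : nat) : nat :=
  let c := lcmn m n %/ l in
  if (l %| lcmn m n) && (c %| beta m n) then
    (totient (gcdn m n) * \prod_(p <- primes (beta m n) | logn p c == 0) (p - 2))
      %/ \prod_(p <- primes (beta m n) | logn p c == 0) (p - 1)
  else 0.

Lemma beta_dvd_gcd m n : beta m n %| gcdn m n.
Proof.
have [->|m0] := posnP m.
  by rewrite /beta big_nil dvd1n.
have part (q : pred nat) : \prod_(p <- primes m | q p) p ^ logn p m %| m.
  rewrite [X in _ %| X](prod_prime_decomp m0) prime_decompE big_map /=.
  by rewrite [X in _ %| X](bigID q) /= dvdn_mulr.
rewrite dvdn_gcd part /=.
have [->|n0] := posnP n; first exact: dvdn0.
rewrite /beta -big_filter; set r := filter _ _.
have -> : \prod_(p <- r) p ^ logn p m = \prod_(p <- r) p ^ logn p n.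
  rewrite [LHS]big_seq [RHS]big_seq; apply: eq_bigr => p.
  by rewrite mem_filter => /andP[/andP[_ /eqP->]].
rewrite [X in _ %| X](prod_prime_decomp n0) prime_decompE big_map /=.
have sub : {subset r <= primes n}.
  move=> p; rewrite mem_filter => /andP[/andP[pm /eqP e] _].
  by rewrite -logn_gt0 -e.
have ur : uniq r by rewrite filter_uniq ?primes_uniq.
rewrite [X in _ %| X](bigID (mem r)) /= -[X in _ %| X * _]big_filter.
rewrite [X in _ %| X * _](perm_big r) ?dvdn_mulr //.
apply: uniq_perm; rewrite ?filter_uniq ?primes_uniq // => p.
rewrite mem_filter; case: (boolP (p \in r)) => //= /sub ->.
by [].
Qed.

Lemma delta_exact m n (q : pred nat) : 0 < m ->
  \prod_(p <- primes (beta m n) | q p) (p - 1) %| totient (gcdn m n).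
Proof.
move=> m0; have g0 : 0 < gcdn m n by rewrite gcdn_gt0 m0.
rewrite totientE // big_split /= dvdn_mulr //.
rewrite -big_filter; set r := filter _ _.
rewrite [X in _ %| X](bigID (mem r)) /= -[X in _ %| X * _]big_filter.
rewrite [X in X %| _](perm_big (filter (mem r) (primes (gcdn m n)))).
  under eq_bigr do rewrite subn1; exact: dvdn_mulr.
apply: uniq_perm; rewrite ?filter_uniq ?primes_uniq // => p.
rewrite [RHS]mem_filter /=; case: (boolP (p \in r)) => //=.
rewrite mem_filter !mem_primes => /andP[_ /and3P[-> _ pb]].
by rewrite g0 (dvdn_trans pb (beta_dvd_gcd m n)).
Qed.

Lemma deltaE m n l c : 0 < m -> 0 < n -> lcmn m n = c * l -> c %| beta m n ->
  ((delta m n l)%:R = (totient (gcdn m n))%:R *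
    \prod_(p <- primes (beta m n) | logn p c == 0%N)
      ((p%:R - 2%:R) / (p%:R - 1)) :> rat)%R.
Proof.
move=> m0 n0 e cb.
have : 0 < lcmn m n by rewrite lcmn_gt0 m0.
rewrite e muln_gt0 => /andP[c0 l0].
rewrite /delta e dvdn_mull // mulnK // cb /=.
rewrite natf_div; last first.
  by rewrite dvdn_mulr // (delta_exact n (fun p => logn p c == 0)).
rewrite natrM -mulrA; congr (_ * _)%R.
rewrite !natr_prod -prodf_div big_seq_cond [RHS]big_seq_cond.
apply: eq_bigr => p; rewrite mem_primes => /andP[/andP[/prime_gt1 p1 _] _].
by rewrite !natrB // ltnW.
Qed.

Lemma delta0 m n l : 0 < m -> 0 < n ->
  ~ (exists2 c, lcmn m n = c * l & c %| beta m n) -> delta m n l = 0.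
Proof.
move=> m0 n0 H; rewrite /delta; case: ifP => // /andP[dl dc].
by case: H; exists (lcmn m n %/ l) => //; rewrite divnK.
Qed.

Definition chi (M N : {fset nat}) (l : nat) : nat :=
  \sum_(m <- M) \sum_(n <- N) delta m n l.

Definition chi_p (M N : {fset nat}) (p m0 n0 l : nat) : nat :=
  if l \in supp (chi M N) then
    \sum_(m <- M | pi_p p m == m0) \sum_(n <- N | pi_p p n == n0) delta m n l
  else 0.

Definition p_edge (L : pred nat) (p la lb : nat) : Prop :=
  [/\ la \in L, lb \in L & exists2 k, 0 < k & la = p ^ k * lb].

Definition sdiOb_sufficient (M N : {fset nat}) : Prop :=
  forall p la lb, prime p -> p_edge (supp (chi M N)) p la lb ->
    (forall m0 n0, m0 \in pi_img p M -> n0 \in pi_img p N ->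
       chi_p M N p m0 n0 lb <= chi_p M N p m0 n0 la) \/
    (forall m0 n0, m0 \in pi_img p M -> n0 \in pi_img p N ->
       chi_p M N p m0 n0 lb >= chi_p M N p m0 n0 la).

(* Main.v *)
Require Import Defs.
From mathcomp Require Import all_boot finmap zify.

Set Implicit Arguments.
Unset Strict Implicit.
Unset Printing Implicit Defensive.

Local Open Scope nat_scope.

(** The number [delta m n l] is a product of local factors, one for each prime
    [p], which depend only on the exponents of [p] in [m], [n] and [l].  Hence
    on a fiber of [pi_p p] the sum [chi_p] is a constant, the value of [delta]
    at the parts prime to [p], times a local sum over the exponents [a] in
    [Kset M p m0] and [b] in [Kset N p n0] ([fiber_sum_conv]), and everything
    is reduced to a question about exponents.

    The local factors are the structure constants of a familiar algebra.  If
    [e_a] is the sum of the elements of order [p ^ a] of a large cyclic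
    [p]-group, then [e_a * e_b] is the sum of the [struct_const a b k * e_k].
    The local sum for two sets [K1], [K2] of exponents, here [conv], is
    therefore the convolution of two functions of the order of an element.
    Put [g a = totient (p ^ a)], [F k] the sum of [g] over [a < k], [A1 k] and
    [A2 k] the same sums restricted to [K1] and [K2], and [C k] the sum of [g]
    over the [a >= k] that lie in both sets.  Then ([convE])
      conv k = C k + [k in K2] A1 k + [k in K1] A2 k - [k in both] F k.
    If [k] is in exactly one of the two sets, this is one of [C + A1] and
    [C + A2], which are nondecreasing functions of [k]; otherwise it is one of
    [C] and [C + A1 + A2 - F], which are nonincreasing; and all four are equal
    at 0.  With the inequality [F k <= g k], which permits passing from one
    function of a pair to the other, this shows that for arbitrary [K1] and
    [K2] the function [conv] increases on the symmetric difference of [K1] and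
    [K2], decreases on its complement, and takes its larger values on the
    former ([conv_up], [conv_down], [conv_vs0]).

    A set compatible with an excellent order is constant below some threshold
    and equal to [S] above it ([subset_compatible_threshold]).  Above both
    thresholds, the symmetric difference of [K1] and [K2] is the set [S] of the
    tensor product; below one of them, [conv] is constant ([conv_const]).  This
    gives the compatibility with the tensor product ([conv_compatible]), hence
    part (a).  Part (b) follows by summing over all fibers.  For part (c), the
    two ends of a [p]-edge are comparable for the tensor product, and the
    direction of the comparison is the same for all fibers. *)

(** * Sets compatible with an excellent order *)

Lemma subset_compatible_le K o k : subset_compatible K o -> K k -> k <= xo_s o.
Proof. by case=> [->|[kK _ ->]] // /andP[]. Qed.

(** The order lists [S] downwards, then the complement of [S] upwards.  So an
    upper set that stops inside [S] keeps the part of [S] above some point, and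
    one that stops in the complement is [S] together with an initial interval. *)
Lemma subset_compatible_threshold K o : subset_compatible K o ->
  exists j (e : bool), forall k, K k = if k < j then e else xo_S o k.
Proof.
have Sle k : xo_S o k = (k <= xo_s o) && xo_S o k.
  by case Sk: (xo_S o k); rewrite ?andbF // (xo_S_le Sk).
case=> [eK|[kK lekK eK]].
  (* All of [0, s]: the interval below s + 1, since S is empty above s. *)
  exists (xo_s o).+1, true => k; rewrite eK ltnS Sle.
  by case: (k <= xo_s o).
case SkK: (xo_S o kK).
  exists kK.+1, false => k; rewrite eK xo_gtE lekK SkK /= ltnS Sle.
  by case: (k <= xo_s o) => //=; case: (xo_S o k); rewrite /= ?if_same // ltnNge;
    case: (k <= kK).
exists kK, true => k; rewrite eK xo_gtE lekK SkK /= [in RHS]Sle.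
case: (leqP k (xo_s o)) => [_|lt] /=; first by case: (xo_S o k); case: (k < kK).
by rewrite ltnNge (leq_trans lekK (ltnW lt)).
Qed.

(** * Convolution of functions of the order in a cyclic group *)

Section CyclicProduct.

Variable g : nat -> nat.

Definition below (K : pred nat) k := \sum_(0 <= a < k | K a) g a.

Definition above B (K : pred nat) k := \sum_(k <= a < B | K a) g a.

(** With [g a] the number of elements of order [p ^ a] in a cyclic group, this
    is the number of ways to write a given element of order [p ^ k] as a product
    of elements of orders [p ^ a] and [p ^ b].  If [a <> b], the product has the
    larger order; if [a = b = k > 0], the first factor must avoid the coset of the
    given element modulo the subgroup of elements of smaller order, and this
    coset has [below predT a] elements. *)
Definition struct_const a b k :=
  if a == b then if k < a then g a else (k == a) * (g a - below predT a)
  else (k == maxn a b) * g (minn a b).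

Definition conv B (K1 K2 : pred nat) k :=
  \sum_(0 <= a < B | K1 a) \sum_(0 <= b < B | K2 b) struct_const a b k.

Lemma belowS K k : below K k.+1 = below K k + K k * g k.
Proof.
by rewrite /below !(big_mkcond K) big_nat_recr //=; case: (K k); rewrite ?mul1n.
Qed.

Lemma below0 K : below K 0 = 0.
Proof. by rewrite /below big_geq. Qed.

Lemma aboveS B K k : k < B -> above B K k = K k * g k + above B K k.+1.
Proof.
by move=> ltkB; rewrite /above big_ltn_cond //; case: (K k); rewrite ?mul1n.
Qed.

Lemma below_le K k : below K k <= below predT k.
Proof.
elim: k => [|k IH]; first by rewrite !below0.
by rewrite !belowS leq_add // leq_mul2r; case: (K k); rewrite orbT.
Qed.

Lemma sum_pick B (K : pred nat) (F : nat -> nat) k : k < B ->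
  \sum_(0 <= b < B | K b) (b == k) * F b = K k * F k.
Proof.
move=> ltkB; rewrite big_mkcond (bigD1_seq k) ?mem_index_iota ?iota_uniq //=.
rewrite eqxx mul1n big1 ?addn0; first by case: (K k); rewrite ?mul1n.
by move=> i /negbTE->; rewrite if_same.
Qed.

Lemma sum_trunc B (K : pred nat) (F : nat -> nat) k : k <= B ->
  \sum_(0 <= b < B | K b) (b < k) * F b = \sum_(0 <= b < k | K b) F b.
Proof.
move=> lekB; rewrite (big_cat_nat (n := k)) //= [X in _ + X]big_nat_cond.
rewrite [X in _ + X]big1 ?addn0; last first.
  by move=> i /andP[/andP[leki _] _]; rewrite ltnNge leki.
rewrite big_nat_cond [RHS]big_nat_cond; apply: eq_bigr => i.
by case/andP=> /andP[_ ->] _; rewrite mul1n.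
Qed.

(** Splitting according to which of [a], [b] equals [k] makes each term a
    product of functions of [a] and of [b], so that double sums factor. *)
Lemma struct_constE a b k :
  struct_const a b k = (b == k) * ((a < k) * g a) + (b < k) * ((a == k) * g b)
    + (b == k) * ((a == k) * (g k - below predT k)) + (b == a) * ((k < a) * g a).
Proof.
rewrite /struct_const.
have [lt|lt|->] := ltngtP a b; last first.
- by case: (ltngtP k b) => [||->]; lia.
- by have [<-|_] := eqVneq a k; have [?|_] := eqVneq b k; lia.
- by have [<-|_] := eqVneq a k; have [?|_] := eqVneq b k; lia.
Qed.

Lemma struct_constC a b k : struct_const a b k = struct_const b a k.
Proof. by rewrite /struct_const maxnC minnC eq_sym; case: eqVneq => // ->. Qed.

Lemma convC B K1 K2 k : conv B K1 K2 k = conv B K2 K1 k.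
Proof.
rewrite /conv exchange_big; apply: eq_bigr => a _; apply: eq_bigr => b _.
exact: struct_constC.
Qed.

Section Mono.

Hypothesis g_super : forall k, below predT k <= g k.

Variables (B : nat) (K1 K2 : pred nat).

Let C := above B (predI K1 K2).
Let A1 := below K1.
Let A2 := below K2.
Let F := below predT.

(** For [a = b = k] the coefficient is [g k - F k]; its part [g k] completes the
    diagonal terms [a = b > k] to [C k], and the remaining [F k] is moved to the
    left to avoid truncated subtraction. *)
Lemma convE k : k < B ->
  conv B K1 K2 k + (K1 k && K2 k) * F k = K2 k * A1 k + K1 k * A2 k + C k.
Proof.
move=> ltkB; have lekB := ltnW ltkB.
transitivity (K2 k * A1 k + K1 k * A2 k + (K1 k && K2 k) * (g k - F k)
    + C k.+1 + (K1 k && K2 k) * F k); last first.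
  rewrite /C (aboveS _ ltkB) /=; have := g_super k; rewrite -/F.
  by case: (K1 k); case: (K2 k) => /=; lia.
congr (_ + _); rewrite /conv.
rewrite (_ : \sum_(0 <= a < B | K1 a) _ = \sum_(0 <= a < B | K1 a)
   ((a < k) * (K2 k * g a) + (a == k) * A2 k
     + (a == k) * (K2 k * (g k - F k)) + K2 a * ((k < a) * g a))).
  rewrite !big_split /= sum_trunc // !sum_pick // -big_distrr /=.
  congr (_ + _ + _ + _); first by rewrite mulnA mulnb.
  rewrite /C /above (big_cat_nat (n := k.+1)) //= big_nat_cond big1 ?add0n.
    rewrite big_nat_cond [RHS]big_nat_cond.
    rewrite big_mkcond [RHS]big_mkcond; apply: eq_bigr => i _ /=.
    case: (leqP k.+1 i) => //= _; case: (i < B) => //=.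
    by case: (K1 i); case: (K2 i) => //=; rewrite ?mul1n.
  move=> i /andP[/andP[_ lt] _]; rewrite ltnNge -ltnS lt; lia.
rewrite big_nat_cond [RHS]big_nat_cond; apply: eq_bigr => a.
case/andP=> /andP[_ ltaB] _; under eq_bigr do rewrite struct_constE.
rewrite !big_split /= !sum_pick // sum_trunc // -big_distrr /= -/(A2 k).
by rewrite (mulnCA (K2 k)) (mulnCA (K2 k) (a == k)).
Qed.

(** From [k] to [k.+1], [C] loses [g k] when [k] is in both sets, each [Ai] gains
    [g k] when [k] is in [Ki], and [F] always gains it. *)
Lemma bounds_mono i k : i <= k <= B ->
  [/\ C k <= C i, C k + A1 k + A2 k + F i <= C i + A1 i + A2 i + F k,
      C i + A1 i <= C k + A1 k & C i + A2 i <= C k + A2 k].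
Proof.
case/andP; elim: k => [|k IH]; first by rewrite leqn0 => /eqP->; split.
rewrite leq_eqVlt => /predU1P[->|]; first by split.
rewrite ltnS => leik ltkB; have [] := IH leik (ltnW ltkB).
rewrite /C /A1 /A2 /F (aboveS _ ltkB) !belowS /=.
by case: (K1 k); case: (K2 k) => /= h1 h2 h3 h4; split; lia.
Qed.

(** The function [C + A1] or [C + A2] that gives the value at [k] need not be the
    one that gives it at [i].  But only the one not used at [i] grows at [i], and
    it grows by [g i], which is at least [A1 i] and [A2 i]. *)
Lemma conv_up i k : i < k < B -> K1 i (+) K2 i -> K1 k (+) K2 k ->
  conv B K1 K2 i <= conv B K1 K2 k.
Proof.
case/andP=> ik kB; have iB := ltn_trans ik kB.
have [|_ _ + +] := @bounds_mono i.+1 k; first by rewrite ik ltnW.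
have := convE iB; have := convE kB; have := g_super i.
have := below_le K1 i; have := below_le K2 i.
rewrite /C (aboveS _ iB) /A1 /A2 /F !belowS /=.
by case: (K1 i); case: (K2 i); case: (K1 k); case: (K2 k) => //=; lia.
Qed.

(** Same argument with [C] and [C + A1 + A2 - F], which differ by at most [F i]
    at [i]: the one not used at [i] drops by [g i >= F i]. *)
Lemma conv_down i k : i < k < B -> ~~ (K1 i (+) K2 i) -> ~~ (K1 k (+) K2 k) ->
  conv B K1 K2 k <= conv B K1 K2 i.
Proof.
case/andP=> ik kB; have iB := ltn_trans ik kB.
have [|+ + _ _] := @bounds_mono i.+1 k; first by rewrite ik ltnW.
have := convE iB; have := convE kB; have := g_super i.
have := below_le K1 i; have := below_le K2 i.
rewrite /C (aboveS _ iB) /A1 /A2 /F !belowS /=.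
by case: (K1 i); case: (K2 i); case: (K1 k); case: (K2 k) => //=; lia.
Qed.

(** All four bounding functions take the value [C 0] at 0. *)
Lemma conv_vs0 k : k < B ->
  if K1 k (+) K2 k then conv B K1 K2 0 <= conv B K1 K2 k
  else conv B K1 K2 k <= conv B K1 K2 0.
Proof.
move=> kB; have B0 : 0 < B by apply: leq_ltn_trans kB.
have [|+ + + +] := @bounds_mono 0 k; first by rewrite leq0n ltnW.
have := convE B0; have := convE kB.
rewrite /A1 /A2 /F !below0.
by case: (K1 k); case: (K2 k) => //=; lia.
Qed.

(** If [K2] is constant on the exponents below [j], its function is constant on
    a subgroup, hence so is any convolution with it. *)
Lemma conv_const j (e : bool) k : (forall a, a < j -> K2 a = e) -> k < j ->
  k < B -> conv B K1 K2 k = conv B K1 K2 0.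
Proof.
move=> K2e kj kB; have B0 : 0 < B by apply: leq_ltn_trans kB.
have [C_A1 A2F] : C k + e * A1 k = C 0 /\ A2 k = e * F k.
  elim: k kj kB => [|k IH] kj kB; first by rewrite /A1 /A2 /F !below0; lia.
  have kB' := ltnW kB; have [] := IH (ltnW kj) kB'.
  rewrite /C (aboveS _ kB') /A1 /A2 /F !belowS /= (K2e _ (ltnW kj)).
  by case: (e); case: (K1 k) => /=; lia.
have := convE B0; have := convE kB; rewrite A2F (K2e _ kj).
rewrite /A1 /A2 /F !below0; move: C_A1; rewrite /A1 /F.
by case: (e); case: (K1 k) => /=; lia.
Qed.

End Mono.
End CyclicProduct.

(** * Compatibility with the tensor product *)

(** Above the larger threshold the set [S] of the tensor product is the symmetric
    difference of [K1] and [K2]; below it the two may differ, but there the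
    convolution has the constant value [f 0], which separates its values on [S]
    from those on the complement. *)
Lemma conv_compatible g B o1 o2 K1 K2 k i :
  (forall e, below g predT e <= g e) ->
  subset_compatible K1 o1 -> subset_compatible K2 o2 ->
  maxn (xo_s o1) (xo_s o2) < B -> xo_gt (xo_tensor o1 o2) k i ->
  conv g B K1 K2 i <= conv g B K1 K2 k.
Proof.
move=> g_super /subset_compatible_threshold[j1 [e1 K1E]].
move=> /subset_compatible_threshold[j2 [e2 K2E]] sB.
pose j := maxn j1 j2; set f := conv g B K1 K2; set o := xo_tensor o1 o2.
have f_const x : x < j -> x < B -> f x = f 0.
  rewrite leq_max => /orP[xj|xj] xB.
    rewrite /f convC [RHS]convC; apply: (conv_const g_super _ _ xj xB).
    by move=> a aj; rewrite K1E aj.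
  apply: (conv_const g_super _ _ xj xB).
  by move=> a aj; rewrite K2E aj.
have S_xor x : j <= x -> xo_S o x = K1 x (+) K2 x.
  rewrite geq_max => /andP[j1x j2x].
  rewrite xo_tensor_S K1E K2E ltnNge j1x ltnNge j2x.
  by case: (xo_S o1 x); case: (xo_S o2 x).
have f_vs0 x : x < B -> if xo_S o x then f 0 <= f x else f x <= f 0.
  move=> xB; have [xj|jx] := ltnP x j; first by rewrite f_const // if_same.
  by rewrite S_xor //; apply: conv_vs0.
have f_up x y : x < y < B -> xo_S o x -> xo_S o y -> f x <= f y.
  case/andP=> xy yB Sx Sy; have xB := ltn_trans xy yB.
  have [xj|jx] := ltnP x j; first by have := f_vs0 y yB; rewrite (f_const x) // Sy.
  by apply: conv_up; rewrite // -?S_xor ?xy // (leq_trans jx) // ltnW.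
have f_down x y : x < y < B -> ~~ xo_S o x -> ~~ xo_S o y -> f y <= f x.
  case/andP=> xy yB Sx Sy; have xB := ltn_trans xy yB.
  have [xj|jx] := ltnP x j.
    by have := f_vs0 y yB; rewrite (f_const x) // (negbTE Sy).
  by apply: conv_down; rewrite // -?S_xor ?xy // (leq_trans jx) // ltnW.
rewrite xo_gtE -/o xo_tensor_s => /and3P[ks is_].
have kB := leq_ltn_trans ks sB; have iB := leq_ltn_trans is_ sB.
have := f_vs0 k kB; have := f_vs0 i iB.
case: ifP => Si; case: ifP => Sk //= f_i f_k.
- by move=> ik; apply: f_up; rewrite ?ik.
- by move=> _; apply: leq_trans f_k.
- by move=> ki; apply: f_down; rewrite ?ki ?Si ?Sk.
Qed.

(** * Splitting off one prime from delta *)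

Lemma below_totient p k : prime p ->
  below (fun e => totient (p ^ e)) predT k = (0 < k) * p ^ k.-1.
Proof.
move=> pr; elim: k => [|k IH]; first by rewrite below0.
rewrite belowS IH; case: k {IH} => [|k]; first by rewrite expn0.
rewrite totient_pfactor //= !mul1n expnS; have := prime_gt0 pr.
by case: p {pr} => // p _; rewrite mulSn.
Qed.

(** For [k > 0] the two sides are [p ^ k.-1] and [p.-1 * p ^ k.-1]. *)
Lemma totient_super p : prime p ->
  forall k, below (fun e => totient (p ^ e)) predT k <= totient (p ^ k).
Proof.
move=> pr k; rewrite below_totient //; case: k => // k.
rewrite totient_pfactor //= mul1n leq_pmull //.
by case: p pr => [|[|p]].
Qed.

Section SplitOff.

Variables (p m n l a b k : nat).
Hypotheses (pr : prime p) (pm : coprime p m) (pn : coprime p n)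
  (pl : coprime p l).

Lemma coprime_pos x : coprime p x -> 0 < x.
Proof. by case: x => // /eqP; rewrite gcdn0 => p1; move: pr; rewrite p1. Qed.

Let p0 : 0 < p. Proof. exact: prime_gt0. Qed.
Let p1 : 1 < p. Proof. exact: prime_gt1. Qed.

Lemma logn_split x e : coprime p x -> logn p (x * p ^ e) = e.
Proof.
move=> px; rewrite lognM ?(coprime_pos px) ?expn_gt0 ?p0 // logn_coprime //.
by rewrite pfactorK.
Qed.

Lemma logn_split_neq q x e : coprime p x -> q != p ->
  logn q (x * p ^ e) = logn q x.
Proof.
move=> px qp; rewrite lognM ?(coprime_pos px) ?expn_gt0 ?p0 // lognX.
by rewrite (logn_prime _ pr) (negbTE qp) muln0 addn0.
Qed.

Lemma gcdn_split : gcdn (m * p ^ a) (n * p ^ b) = gcdn m n * p ^ minn a b.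
Proof.
have [m0 n0 ?] := And3 (coprime_pos pm) (coprime_pos pn) p0.
have pg : coprime p (gcdn m n) by apply: coprime_dvdr pm; rewrite dvdn_gcdl.
have P x : 0 < p ^ x by rewrite expn_gt0 p0.
have [gp mp np] : [/\ 0 < gcdn m n, 0 < m * p ^ a & 0 < n * p ^ b].
  by rewrite gcdn_gt0 m0 !muln_gt0 m0 n0 !P.
apply: eqn_from_log => [||q]; [by rewrite gcdn_gt0 mp | by rewrite muln_gt0 gp P |].
rewrite logn_gcd //; have [->|qp] := eqVneq q p; first by rewrite !logn_split.
by rewrite !logn_split_neq // logn_gcd.
Qed.

Lemma coprime_lcm : coprime p (lcmn m n).
Proof.
apply: (@coprime_dvdr _ (m * n)); last by rewrite coprimeMr pm.
by rewrite dvdn_lcm dvdn_mulr // dvdn_mull.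
Qed.

Lemma lcmn_split : lcmn (m * p ^ a) (n * p ^ b) = lcmn m n * p ^ maxn a b.
Proof.
have [m0 n0] := (coprime_pos pm, coprime_pos pn).
have pg := coprime_lcm.
have P x : 0 < p ^ x by rewrite expn_gt0 p0.
have [gp mp np] : [/\ 0 < lcmn m n, 0 < m * p ^ a & 0 < n * p ^ b].
  by rewrite lcmn_gt0 !muln_gt0 m0 n0 !P.
apply: eqn_from_log => [||q]; [by rewrite lcmn_gt0 mp | by rewrite muln_gt0 gp P |].
rewrite logn_lcm //; have [->|qp] := eqVneq q p; first by rewrite !logn_split.
by rewrite !logn_split_neq // logn_lcm.
Qed.

Lemma perm_primes_split x e : coprime p x ->
  perm_eq (primes (x * p ^ e)) (if 0 < e then p :: primes x else primes x).
Proof.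
move=> px; have x0 := coprime_pos px.
case: e => [|e]; first by rewrite muln1.
have npx : p \notin primes x by rewrite mem_primes pr x0 -prime_coprime.
apply: uniq_perm; rewrite ?primes_uniq //= ?npx ?primes_uniq // => q.
by rewrite primesM ?expn_gt0 ?p0 // primesX // (primes_prime pr) !inE orbC.
Qed.

Lemma beta_split :
  beta (m * p ^ a) (n * p ^ b) = beta m n * p ^ (if a == b then a else 0).
Proof.
rewrite /beta (perm_big _ (perm_primes_split a pm)) /=.
have E : \prod_(q <- primes m | (0 < logn q (m * p ^ a)) &&
        (logn q (m * p ^ a) == logn q (n * p ^ b))) q ^ logn q (m * p ^ a)
   = beta m n.
  rewrite /beta big_seq_cond [RHS]big_seq_cond.
  have H q : q \in primes m -> q != p.
    rewrite mem_primes => /and3P[_ _ qm]; apply/eqP => qp.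
    by move: pm; rewrite prime_coprime // -qp qm.
  apply: eq_big => [q|q /andP[/H qp _]]; last by rewrite logn_split_neq.
  by case qm: (q \in primes m) => //=; rewrite !logn_split_neq // H.
case: posnP E => [->|a0] E; first by rewrite E if_same muln1.
rewrite big_cons !logn_split // a0 /= E.
by case: eqP; rewrite ?muln1 // mulnC.
Qed.

Lemma dvdn_split x y e f : coprime p x -> coprime p y ->
  (x * p ^ e %| y * p ^ f) = (x %| y) && (e <= f).
Proof.
move=> px py; rewrite Gauss_dvd; last by rewrite coprime_sym coprimeXl.
rewrite Gauss_dvdl; last by rewrite coprime_sym coprimeXl.
by rewrite Gauss_dvdr ?coprimeXl // dvdn_Pexp2l.
Qed.

Lemma coprime_beta : coprime p (beta m n).
Proof.
apply: coprime_dvdr pm; apply: dvdn_trans (beta_dvd_gcd m n) _.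
exact: dvdn_gcdl.
Qed.

Lemma totient_split x e : coprime p x ->
  totient (x * p ^ e) = totient x * totient (p ^ e).
Proof. by move=> px; rewrite totient_coprime // coprime_sym coprimeXl. Qed.

Lemma prod_primes_split (h : nat -> nat) c j e : coprime p c ->
  \prod_(q <- primes (beta m n * p ^ e) | logn q (c * p ^ j) == 0) h q
  = (if (0 < e) && (j == 0) then h p else 1)
    * \prod_(q <- primes (beta m n) | logn q c == 0) h q.
Proof.
move=> pc; rewrite (perm_big _ (perm_primes_split e coprime_beta)).
have E : \prod_(q <- primes (beta m n) | logn q (c * p ^ j) == 0) h q
    = \prod_(q <- primes (beta m n) | logn q c == 0) h q.
  rewrite big_seq_cond [RHS]big_seq_cond; apply: eq_bigl => q.
  case qb: (q \in _) => //=; rewrite logn_split_neq //.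
  move: qb; rewrite mem_primes => /and3P[_ _ qm]; apply/eqP => qp.
  by move: coprime_beta; rewrite prime_coprime // -qp qm.
case: posnP => _ /=; first by rewrite E mul1n.
by rewrite big_cons logn_split // E; case: eqP; rewrite ?mul1n.
Qed.

(** The only interaction of [p] with the quotient in the definition of [delta] is
    for [a = b = k > 0], where [totient (p ^ a)] provides the factor [p - 1] that
    cancels; the other divisions are exact by [delta_exact]. *)
Lemma delta_split :
  delta (m * p ^ a) (n * p ^ b) (l * p ^ k)
  = struct_const (fun e => totient (p ^ e)) a b k * delta m n l.
Proof.
rewrite /delta lcmn_split gcdn_split beta_split dvdn_split ?coprime_lcm //.
case dl: (l %| lcmn m n) => /=; last by rewrite muln0.
set c := lcmn m n %/ l; have ec : lcmn m n = c * l by rewrite divnK.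
have pc : coprime p c.
  by move: coprime_lcm; rewrite ec coprimeMr => /andP[].
case: (leqP k (maxn a b)) => [lek|ltk]; last first.
  rewrite /struct_const (gtn_eqF ltk) /=.
  case: eqP ltk => [->|_]; last by rewrite mul0n.
  by rewrite maxnn => ltk; rewrite ltnNge (ltnW ltk) (gtn_eqF ltk) mul0n.
have -> : (lcmn m n * p ^ maxn a b) %/ (l * p ^ k) = c * p ^ (maxn a b - k).
  rewrite ec -(subnK lek) expnD mulnACA addnK mulnK //.
  by rewrite muln_gt0 coprime_pos // expn_gt0 p0.
rewrite /= dvdn_split ?coprime_beta //.
case: (c %| beta m n); rewrite /= ?muln0 ?if_same //.
set Q := (X in (_ * X) %/ _); set D := (X in _ %/ X).
have -> : Q = (if (0 < (if a == b then a else 0)) && (maxn a b - k == 0)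
     then p - 2 else 1)
     * \prod_(q <- primes (beta m n) | logn q c == 0) (q - 2).
  exact: (prod_primes_split (fun q => q - 2)).
have -> : D = (if (0 < (if a == b then a else 0)) && (maxn a b - k == 0)
     then p - 1 else 1)
     * \prod_(q <- primes (beta m n) | logn q c == 0) (q - 1).
  exact: (prod_primes_split (fun q => q - 1)).
rewrite totient_split; last first.
  by apply: coprime_dvdr pm; apply: dvdn_gcdl.
have := delta_exact n (fun q => logn q c == 0) (coprime_pos pm).
set T := totient _; set X := \prod_(_ <- _ | _) (_ - 2).
set Y := \prod_(_ <- _ | _) _ => YT.
have YTX : Y %| T * X by rewrite dvdn_mulr.
move: lek; rewrite /struct_const; have [->|ab] := eqVneq a b => lek; last first.
  rewrite leqn0 !subn_eq0 /= !mul1n.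
  have -> : (k == maxn a b) = (maxn a b <= k) by rewrite eqn_leq lek.
  by case: (_ <= k); rewrite ?mul0n // ?mul1n mulnAC mulnC muln_divA.
move: lek; rewrite minnn maxnn leq_subLR leq_addl => lek.
rewrite subn_eq0; case: (ltngtP k b) lek => //= [_ _|_ _].
  by rewrite andbF !mul1n mulnAC mulnC muln_divA.
rewrite andbT mul1n below_totient //.
case: b => [|e] /=; first by rewrite expn0 (_ : totient 1 = 1) // muln1 !mul1n.
rewrite totient_pfactor // !mul1n -subn1.
have -> : (p - 1) * p ^ e - p ^ e = (p - 2) * p ^ e.
  by rewrite -{2}(mul1n (p ^ e)) -mulnBl -subnDA.
have -> : T * ((p - 1) * p ^ e) * ((p - 2) * X)
    = (p - 1) * (((p - 2) * p ^ e) * (T * X)) by nia.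
by rewrite divnMl ?subn_gt0 // muln_divA.
Qed.

End SplitOff.

(** * Sums over the fibers of pi_p *)

Lemma pi_pK p m : pi_p p m * p ^ logn p m = m.
Proof. by rewrite /pi_p divnK // pfactor_dvdnn. Qed.

Lemma coprime_pi_p p m : prime p -> 0 < m -> coprime p (pi_p p m).
Proof.
move=> pr m0; have [m' pm' em] := pfactor_coprime pr m0.
by rewrite /pi_p {1}em mulnK // expn_gt0 prime_gt0.
Qed.

Lemma pi_p_split p x e : prime p -> coprime p x -> pi_p p (x * p ^ e) = x.
Proof.
by move=> pr px; rewrite /pi_p logn_split // mulnK // expn_gt0 prime_gt0.
Qed.

Lemma pi_imgP p (M : {fset nat}) m0 :
  reflect (exists2 m, m \in M & m0 = pi_p p m) (m0 \in pi_img p M).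
Proof. exact: imfsetP. Qed.

Lemma coprime_pi_img p (M : {fset nat}) m0 : prime p -> 0 \notin M ->
  m0 \in pi_img p M -> coprime p m0.
Proof.
move=> pr M0 /pi_imgP[m mM ->]; apply: coprime_pi_p => //.
by rewrite lt0n; apply: contraNneq M0 => <-.
Qed.

(** The fiber of [pi_p p] over [m0] is parametrised by the exponent of [p]. *)
Lemma sum_fiber p (M : {fset nat}) m0 B (F : nat -> nat) :
  prime p -> coprime p m0 -> (forall a, Kset M p m0 a -> a < B) ->
  \sum_(m <- M | pi_p p m == m0) F m
  = \sum_(0 <= a < B | Kset M p m0 a) F (m0 * p ^ a).
Proof.
move=> pr pm0 KB; rewrite -big_filter -[RHS]big_filter.
rewrite -(big_map (fun a => m0 * p ^ a) xpredT F); apply: perm_big.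
have inj : injective (fun a => m0 * p ^ a).
  by move=> a b /(congr1 (logn p)); rewrite !logn_split.
apply: uniq_perm.
- by rewrite filter_uniq ?fset_uniq.
- by rewrite map_inj_uniq ?filter_uniq ?iota_uniq.
move=> m; rewrite mem_filter; apply/andP/mapP => [[/eqP em mM]|[a]].
  exists (logn p m); last by rewrite -em pi_pK.
  have K : Kset M p m0 (logn p m) by rewrite /Kset /= -em pi_pK.
  by rewrite mem_filter K mem_index_iota KB.
by rewrite mem_filter => /andP[aK _] ->; rewrite pi_p_split // eqxx.
Qed.

(** The formula for [chi_p] without the restriction to the support of [chi], so
    that [chi] is the sum of these functions at every [l]. *)
Definition fiber_sum (M N : {fset nat}) p m0 n0 l :=
  \sum_(m <- M | pi_p p m == m0) \sum_(n <- N | pi_p p n == n0) delta m n l.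

Lemma chi_fiber_sum M N p l : chi M N l =
  \sum_(m0 <- pi_img p M) \sum_(n0 <- pi_img p N) fiber_sum M N p m0 n0 l.
Proof.
rewrite /chi (partition_big_imfset _ (pi_p p)) /=; apply: eq_bigr => m0 _.
rewrite [RHS]exchange_big; apply: eq_bigr => m _.
exact: partition_big_imfset.
Qed.

Lemma chi_pE M N p m0 n0 l : m0 \in pi_img p M -> n0 \in pi_img p N -> 0 < l ->
  chi_p M N p m0 n0 l = fiber_sum M N p m0 n0 l.
Proof.
move=> m0M n0N l0; rewrite /chi_p inE l0 /=; case: posnP => // chi0.
symmetry; apply/eqP; move/eqP: chi0; rewrite (chi_fiber_sum M N p).
rewrite sum_nat_seq_eq0 => /allP/(_ _ m0M) /=.
by rewrite sum_nat_seq_eq0 => /allP/(_ _ n0N).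
Qed.

Lemma fiber_sum_conv M N p m0 n0 B l :
  prime p -> coprime p m0 -> coprime p n0 -> 0 < l ->
  (forall a, Kset M p m0 a -> a < B) -> (forall b, Kset N p n0 b -> b < B) ->
  fiber_sum M N p m0 n0 l =
  conv (fun e => totient (p ^ e)) B (Kset M p m0) (Kset N p n0) (logn p l)
    * delta m0 n0 (pi_p p l).
Proof.
move=> pr pm0 pn0 l0 KM KN; have pl := coprime_pi_p pr l0.
rewrite /fiber_sum (sum_fiber _ pr pm0 KM) big_distrl; apply: eq_bigr => a _.
rewrite (sum_fiber _ pr pn0 KN) big_distrl; apply: eq_bigr => b _ /=.
by rewrite -{1}(pi_pK p l) delta_split.
Qed.

Definition fiber_compatible p o (M : {fset nat}) :=
  forall m0, m0 \in pi_img p M -> subset_compatible (Kset M p m0) o.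

(** * Monotonicity along edges *)

Section FiberCompatible.

Variables (M N : {fset nat}) (p : nat) (o1 o2 : excellent_order).
Hypotheses (pr : prime p) (M_pos : 0 \notin M) (N_pos : 0 \notin N).
Hypotheses (M_comp : fiber_compatible p o1 M) (N_comp : fiber_compatible p o2 N).

Lemma fiber_sum_mono m0 n0 la lb : m0 \in pi_img p M -> n0 \in pi_img p N ->
  0 < la -> 0 < lb -> pi_p p la = pi_p p lb ->
  xo_gt (xo_tensor o1 o2) (logn p la) (logn p lb) ->
  fiber_sum M N p m0 n0 lb <= fiber_sum M N p m0 n0 la.
Proof.
move=> m0M n0N la0 lb0 pi_ab gt_ab.
have Kle a : Kset M p m0 a -> a < (maxn (xo_s o1) (xo_s o2)).+1.
  by move/(subset_compatible_le (M_comp m0M)); rewrite ltnS leq_max => ->.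
have Kle' b : Kset N p n0 b -> b < (maxn (xo_s o1) (xo_s o2)).+1.
  move/(subset_compatible_le (N_comp n0N)).
  by rewrite ltnS leq_max orbC => ->.
have [pm0 pn0] := (coprime_pi_img pr M_pos m0M, coprime_pi_img pr N_pos n0N).
rewrite !(fiber_sum_conv pr pm0 pn0 _ Kle Kle') // pi_ab leq_mul2r.
apply/orP; right; apply: conv_compatible gt_ab => //; first exact: totient_super.
  exact: M_comp.
exact: N_comp.
Qed.

Lemma chi_p_mono m0 n0 la lb : m0 \in pi_img p M -> n0 \in pi_img p N ->
  0 < la -> 0 < lb -> pi_p p la = pi_p p lb ->
  xo_gt (xo_tensor o1 o2) (logn p la) (logn p lb) ->
  chi_p M N p m0 n0 lb <= chi_p M N p m0 n0 la.
Proof. by move=> m0M n0N la0 lb0 *; rewrite !chi_pE //; apply: fiber_sum_mono. Qed.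

Lemma chi_mono la lb :
  0 < la -> 0 < lb -> pi_p p la = pi_p p lb ->
  xo_gt (xo_tensor o1 o2) (logn p la) (logn p lb) -> chi M N lb <= chi M N la.
Proof.
move=> la0 lb0 pi_ab gt_ab; rewrite !(chi_fiber_sum M N p) big_seq [leqRHS]big_seq.
apply: leq_sum => m0 m0M; rewrite big_seq [leqRHS]big_seq; apply: leq_sum => n0 n0N.
exact: fiber_sum_mono.
Qed.

End FiberCompatible.

Lemma supp_chi M N l : 0 \notin M -> 0 \notin N -> l \in supp (chi M N) ->
  exists m n, [/\ m \in M, n \in N, 0 < m, 0 < n & l %| lcmn m n].
Proof.
move=> M0 N0; rewrite inE => /andP[_].
rewrite lt0n sum_nat_seq_neq0 => /hasP[m mM] /=.
rewrite sum_nat_seq_neq0 => /hasP[n nN] /= d0.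
exists m, n; split=> //; rewrite ?lt0n.
- by apply: contraNneq M0 => <-.
- by apply: contraNneq N0 => <-.
by move: d0; rewrite /delta; case: (l %| _).
Qed.

Lemma fiber_compatible_le p o (M : {fset nat}) m : fiber_compatible p o M ->
  m \in M -> logn p m <= xo_s o.
Proof.
move=> M_comp mM; have pM : pi_p p m \in pi_img p M by apply/pi_imgP; exists m.
by apply: (subset_compatible_le (M_comp _ pM)); rewrite /Kset /= pi_pK.
Qed.

Lemma logn_supp_chi M N p o1 o2 l : prime p -> 0 \notin M -> 0 \notin N ->
  fiber_compatible p o1 M -> fiber_compatible p o2 N ->
  l \in supp (chi M N) -> logn p l <= xo_s (xo_tensor o1 o2).
Proof.
move=> pr M0 N0 cM cN /(supp_chi M0 N0)[m [n [mM nN m0 n0 ldiv]]].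
have lcm0 : 0 < lcmn m n by rewrite lcmn_gt0 m0.
apply: leq_trans (dvdn_leq_log p lcm0 ldiv) _.
rewrite logn_lcm // xo_tensor_s geq_max !leq_max.
by rewrite (fiber_compatible_le cM mM) (fiber_compatible_le cN nN) orbT.
Qed.

(** When [p] divides no element, every nonempty fiber has the exponent set {0}. *)
Lemma fiber_compatible_off p o (M : {fset nat}) : prime p -> 0 \notin M ->
  p \notin primes_of M -> xo_S o =1 pred0 -> fiber_compatible p o M.
Proof.
move=> pr M0 pM S0 m0 m0M.
have ndiv m : m \in M -> ~~ (p %| m).
  by move=> mM; apply: contra pM => pm; rewrite inE pr; apply/hasP; exists m.
have KE k : Kset M p m0 k = (k == 0).
  apply/idP/eqP => [/ndiv|->]; first by case: k => // k; rewrite expnS mulnCA dvdn_mulr.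
  rewrite /Kset /= muln1; case/pi_imgP: m0M => m mM ->.
  by rewrite /pi_p lognE (negbTE (ndiv m mM)) !andbF divn1.
by case/normalised_offP: S0 => [H|[kK le H]]; [left|right; exists kK] => // k;
  rewrite KE -H.
Qed.

Lemma fiber_compatible_normalised P o (M : {fset nat}) p : prime p ->
  set_compatible P o M -> normalised_off M o p -> fiber_compatible p (o p) M.
Proof.
move=> pr [_ M0 _ _ cM] off; case: (boolP (p \in primes_of M)) => [/cM//|pM].
exact: fiber_compatible_off (off pM).
Qed.

(** Since sdiOb-sufficiency does not mention the orders, the order at a prime that
    divides no element may be replaced by the trivial one. *)
Lemma fiber_compatible_ex P o (M : {fset nat}) p : prime p ->
  set_compatible P o M -> exists o', fiber_compatible p o' M.
Proof.
move=> pr [_ M0 _ _ cM]; case: (boolP (p \in primes_of M)) => [/cM H|pM].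
  by exists (o p).
exists (mk_excellent 0 pred0); apply: fiber_compatible_off => // k.
by rewrite /xo_S /= mk_gt0 /mk_S /= andbF.
Qed.

Lemma in_V_gt0 (P : {fset nat}) o m : (forall p, p \in P -> prime p) ->
  in_V P o m -> 0 < m.
Proof.
move=> P_prime [k [_ ->]]; rewrite big_seq; apply: prodn_cond_gt0 => p pP.
by rewrite expn_gt0 prime_gt0 ?P_prime.
Qed.

Lemma in_V_logn (P : {fset nat}) o m : (forall p, p \in P -> prime p) -> 0 < m ->
  (forall p, p \in primes m -> p \in P) ->
  (forall p, p \in P -> logn p m <= xo_s (o p)) -> in_V P o m.
Proof.
move=> P_prime m0 mP le_s; exists (fun p => logn p m); split=> //.
rewrite {1}(prod_prime_decomp m0) prime_decompE big_map /=.
rewrite [RHS](bigID (mem (primes m))) /= [X in _ * X]big1 ?muln1; last first.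
  by move=> p; rewrite -logn_gt0 -eqn0Ngt => /eqP->.
rewrite -[RHS]big_filter; apply: perm_big; apply: uniq_perm.
- exact: primes_uniq.
- by rewrite filter_uniq ?fset_uniq.
by move=> p; rewrite mem_filter /=; case: (boolP (p \in primes m)) => // /mP ->.
Qed.

(** * The theorem *)

Local Open Scope fset_scope.

Theorem theorem9p9 (M N P : {fset nat}) (oM oN : nat -> excellent_order)
    (M_neq0 : M != fset0) (N_neq0 : N != fset0)
    (M_pos : 0 \notin M) (N_pos : 0 \notin N)
    (P_prime : forall p, p \in P -> prime p)
    (PM : {subset primes_of M <= P}) (PN : {subset primes_of N <= P})
    (M_comp : set_compatible P oM M) (N_comp : set_compatible P oN N) :
  let oL p := xo_tensor (oM p) (oN p) in
  [/\ (forall p, p \in P -> normalised_off M oM p -> normalised_off N oN p ->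
        forall m0 n0, m0 \in pi_img p M -> n0 \in pi_img p N ->
        forall la lb, edgeVp P oL p la lb ->
          chi_p M N p m0 n0 la >= chi_p M N p m0 n0 lb),
      ((forall p, p \in P -> normalised_off M oM p /\ normalised_off N oN p) ->
        fun_compatible P oL (chi M N)) &
      sdiOb_sufficient M N].
Proof.
move=> oL.
have supp_P p l : prime p -> l \in supp (chi M N) -> p %| l -> p \in P.
  move=> pr /(supp_chi M_pos N_pos)[m [n [mM nN m0 n0 ldiv]]] pl.
  have: p %| m * n by apply: dvdn_trans (dvdn_trans pl ldiv) _;
    rewrite dvdn_lcm dvdn_mulr // dvdn_mull.
  rewrite Euclid_dvdM // => /orP[pm|pn]; [apply: PM|apply: PN]; rewrite inE pr.
    by apply/hasP; exists m.
  by apply/hasP; exists n.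
split.
- move=> p pP offM offN m0 n0 m0M n0N la lb [Va Vb pi_ab gt_ab].
  have pr := P_prime p pP.
  have cM := fiber_compatible_normalised pr M_comp offM.
  have cN := fiber_compatible_normalised pr N_comp offN.
  apply: (chi_p_mono pr M_pos N_pos cM cN) => //.
    exact: in_V_gt0 P_prime Va.
  exact: in_V_gt0 P_prime Vb.
- move=> off.
  have cMN p : p \in P ->
      fiber_compatible p (oM p) M /\ fiber_compatible p (oN p) N.
    move=> pP; have [offM offN] := off p pP; have pr := P_prime p pP.
    by split; [apply: fiber_compatible_normalised M_comp offM
              |apply: fiber_compatible_normalised N_comp offN].
  split=> //.
  + exists [fset l | l in flatten [seq divisors (lcmn m n) | m <- M, n <- N]].
    move=> l /(supp_chi M_pos N_pos)[m [n [mM nN m0 n0 ldiv]]].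
    rewrite inE /=; apply/flattenP; exists (divisors (lcmn m n)).
      by apply/allpairsP; exists (m, n).
    by rewrite -dvdn_divisors // lcmn_gt0 m0.
  + move=> l lL; have l0 : 0 < l by case/andP: lL.
    apply: in_V_logn => // [p|p pP].
      by rewrite mem_primes => /and3P[pr _ pl]; apply: supp_P pl.
    by have [cM cN] := cMN p pP; apply: logn_supp_chi lL; rewrite ?P_prime.
  + move=> la lb [p pP [Va Vb pi_ab gt_ab]]; have [cM cN] := cMN p pP.
    apply: (chi_mono (P_prime p pP) M_pos N_pos cM cN) => //.
      exact: in_V_gt0 P_prime Va.
    exact: in_V_gt0 P_prime Vb.
- move=> p la lb pr [laL lbL [k k0 lab]].
  have [o1 c1] := fiber_compatible_ex pr M_comp.
  have [o2 c2] := fiber_compatible_ex pr N_comp.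
  have [la0 lb0] : 0 < la /\ 0 < lb by case/andP: laL; case/andP: lbL.
  have log_ab : logn p la = (k + logn p lb)%N.
    by rewrite lab lognM ?expn_gt0 ?(prime_gt0 pr) // pfactorK.
  have pi_ab : pi_p p la = pi_p p lb.
    by rewrite /pi_p log_ab lab expnD divnMl // expn_gt0 prime_gt0.
  have las := logn_supp_chi pr M_pos N_pos c1 c2 laL.
  have lbs := logn_supp_chi pr M_pos N_pos c1 c2 lbL.
  have neq : logn p la != logn p lb by rewrite log_ab; lia.
  case/orP: (xo_total las lbs neq) => gt; [left|right] => m0 n0 m0M n0N.
    exact: (chi_p_mono pr M_pos N_pos c1 c2).
  by apply: (chi_p_mono pr M_pos N_pos c1 c2).
Qed.
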